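(* Let $A$ be a unital semisimple (complex) Banach algebra with essential socle, let $X$ be a complex Banach space, and let $\Phi:A\to B(X)$ be a surjective linear map. The following are equivalent: (1) For all $a,b\in A$: $a\leq^- b$ if and only if $\Phi(a)\leq^-\Phi(b)$. (2) $\Phi$ is either an isomorphism multiplied by an invertible element, or an anti-isomorphism multiplied by an invertible element; i.e. there exist an invertible $c\in B(X)$ and a map $\Psi:A\to B(X)$ which is an algebra isomorphism or an algebra anti-isomorphism such that $\Phi(x)=c\,\Psi(x)$ for all $x\in A$.
   Context: $B(X)$ is the algebra of all bounded linear operators on $X$. For a unital ring $R$, $R^\bullet$ is the set of idempotents, $\mathrm{ann}_l(a)=\{x\in R: xa=0\}$ and $\mathrm{ann}_r(a)=\{x\in R: ax=0\}$. For $a,b\in R$, $a\leq^- b$ means that there exist $p,q\in R^\bullet$ with $\mathrm{ann}_l(a)=\mathrm{ann}_l(p)$, $\mathrm{ann}_r(a)=\mathrm{ann}_r(q)$, $pa=pb$ and $aq=bq$. The socle $\mathrm{Soc}(A)$ of a semisimple Banach algebra $A$ is the sum of all minimal left ideals of $A$ (equivalently of all minimal right ideals), and is $\{0\}$ if there are none. A non-zero ideal $I$ is essential if it has non-zero intersection with every non-zero ideal of $A$; for semisimple $A$ this is equivalent to: $aI=0$ with $a\in A$ implies $a=0$. *)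

(* Defs.v *)
From HB Require Import structures.
From mathcomp Require Import all_boot all_order all_algebra.
From mathcomp Require Import complex.
From mathcomp Require Import all_classical all_reals all_analysis.
Set Implicit Arguments.
Unset Strict Implicit.
Unset Printing Implicit Defensive.
Import Order.TTheory GRing.Theory Num.Theory.
Import numFieldNormedType.Exports.
Local Open Scope classical_set_scope.
Local Open Scope ring_scope.

(* A Banach algebra with unit 1 != 0 is a Banach space with a bilinear,
   associative, unital and submultiplicative product.  The product is part of
   the mixin, and the algType structure is derived from it below, because a
   structure joining NormedModule and GRing.Algebra cannot be declared after
   Num.NumDomain.  The normalization `|1| = 1 is not imposed: it can always be
   achieved by an equivalent norm. *)
HB.mixin Record CompleteNormedModule_isBanachAlgebra (K : numFieldType) A
    of CompleteNormedModule K A := {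
  balg_one : A;
  balg_mul : A -> A -> A;
  balg_mulA : associative balg_mul;
  balg_mul1l : left_id balg_one balg_mul;
  balg_mul1r : right_id balg_one balg_mul;
  balg_mulDl : left_distributive balg_mul +%R;
  balg_mulDr : right_distributive balg_mul +%R;
  balg_one_neq0 : balg_one != 0;
  balg_scaleAl : forall (k : K) (x y : A),
    k *: balg_mul x y = balg_mul (k *: x) y;
  balg_scaleAr : forall (k : K) (x y : A),
    k *: balg_mul x y = balg_mul x (k *: y);
  balg_normM : forall x y : A, `|balg_mul x y| <= `|x| * `|y|
}.

#[short(type="banachAlgType")]
HB.structure Definition BanachAlgebra (K : numFieldType) :=
  {A of CompleteNormedModule K A & CompleteNormedModule_isBanachAlgebra K A}.

Section BanachAlgebraIsAlgebra.
Variables (K : numFieldType) (A : banachAlgType K).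

#[non_forgetful_inheritance]
HB.instance Definition _ := GRing.Zmodule_isNzRing.Build (BanachAlgebra.sort A)
  (@balg_mulA K A) (@balg_mul1l K A) (@balg_mul1r K A)
  (@balg_mulDl K A) (@balg_mulDr K A) (@balg_one_neq0 K A).
#[non_forgetful_inheritance]
HB.instance Definition _ :=
  GRing.Lmodule_isLalgebra.Build K (BanachAlgebra.sort A) (@balg_scaleAl K A).
#[non_forgetful_inheritance]
HB.instance Definition _ :=
  GRing.Lalgebra_isAlgebra.Build K (BanachAlgebra.sort A) (@balg_scaleAr K A).

Lemma banach_normM (x y : A) : `|x * y| <= `|x| * `|y|.
Proof. exact: balg_normM. Qed.

End BanachAlgebraIsAlgebra.

Section RingNotions.
Variable R : pzRingType.
Implicit Types (a b p q x y : R) (I J M L : set R).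

Definition idempotents : set R := [set p | p * p = p].
Definition ann_l a : set R := [set x | x * a = 0].
Definition ann_r a : set R := [set x | a * x = 0].

Definition minus_le a b : Prop :=
  exists p q, [/\ idempotents p /\ idempotents q,
    ann_l a = ann_l p, ann_r a = ann_r q, p * a = p * b & a * q = b * q].

Definition invertible a : Prop := exists b, a * b = 1 /\ b * a = 1.

(* In a unital algebra the left (resp. two-sided) ring ideals are
   automatically linear subspaces, and they are closed under opposite since
   - x = (-1) * x. *)
Definition left_ideal I : Prop :=
  [/\ I 0, forall x y, I x -> I y -> I (x + y)
    & forall a x, I x -> I (a * x)].

Definition two_sided_ideal I : Prop :=
  left_ideal I /\ forall a x, I x -> I (x * a).

Definition minimal_left_ideal L : Prop :=
  [/\ left_ideal L, L <> [set 0]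
    & forall J, left_ideal J -> J `<=` L -> J = [set 0] \/ J = L].

Definition maximal_left_ideal M : Prop :=
  [/\ left_ideal M, M <> setT
    & forall J, left_ideal J -> M `<=` J -> J = M \/ J = setT].

Definition jacobson_radical : set R :=
  \bigcap_(M in maximal_left_ideal) M.

Definition semisimple : Prop := jacobson_radical = [set 0].

(* The sum of all minimal left ideals, as the set of finite sums of elements
   of minimal left ideals; the empty sum gives {0} when there are none. *)
Definition socle : set R :=
  [set x | exists s : seq R,
     (forall y, y \in s -> exists2 L, minimal_left_ideal L & L y)
     /\ x = \sum_(y <- s) y].

Definition essential_ideal I : Prop :=
  [/\ two_sided_ideal I, I <> [set 0]
    & forall J, two_sided_ideal J -> J <> [set 0] -> I `&` J <> [set 0]].

End RingNotions.

Arguments jacobson_radical : clear implicits.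
Arguments socle : clear implicits.

(* The algebra B(X) of bounded linear operators on X, with composition as
   product.  It is only a possibly zero ring, since X may be the zero space. *)
Section BoundedOperators.
Variables (K : numFieldType) (X : normedModType K).

Definition bounded_linear : {pred X -> X} :=
  fun f => `[< linear f /\ exists M : K, forall x, `|f x| <= M * `|x| >].

Lemma bounded_linearP f :
  reflect (linear f /\ exists M : K, forall x, `|f x| <= M * `|x|)
          (f \in bounded_linear).
Proof. exact: asboolP. Qed.

Lemma bounded_linear_bound f : f \in bounded_linear ->
  exists2 M : K, 0 <= M & forall x, `|f x| <= M * `|x|.
Proof.
move=> /bounded_linearP[lf [M fM]].
have [[x x0]|X0] := pselect (exists x : X, x != 0).
  exists M => //; have := le_trans (normr_ge0 _) (fM x).
  by rewrite pmulr_lge0// normr_gt0.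
exists 0 => // x; have -> : x = 0.
  by apply/eqP/negPn/negP => x0; apply: X0; exists x.
by rewrite normr0 mulr0; have := fM 0; rewrite normr0 mulr0.
Qed.

Lemma bounded_linear_submod_closed : submod_closed bounded_linear.
Proof.
split.
  apply/bounded_linearP; split; last first.
    by exists 0 => x; rewrite mul0r normr0.
  by move=> a x y; rewrite /GRing.zero /= scaler0 addr0.
move=> a f g Bf Bg; apply/bounded_linearP.
have [M M0 fM] := bounded_linear_bound Bf.
have [N N0 gN] := bounded_linear_bound Bg.
have /bounded_linearP[lf _] := Bf; have /bounded_linearP[lg _] := Bg.
split=> [b x y|].
  rewrite /= !fctE lf lg !scalerDr !scalerA mulrC -!addrA; congr (_ + _).
  by rewrite addrCA.
exists (`|a| * M + N) => x.
rewrite mulrDl (le_trans (ler_normD _ _))// lerD// normrZ -mulrA.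
by rewrite ler_wpM2l.
Qed.

Lemma bounded_linear_id : (idfun : X -> X) \in bounded_linear.
Proof. by apply/bounded_linearP; split=> //; exists 1 => x; rewrite mul1r. Qed.

Lemma bounded_linear_comp f g : f \in bounded_linear -> g \in bounded_linear ->
  f \o g \in bounded_linear.
Proof.
move=> Bf Bg; apply/bounded_linearP.
have [M M0 fM] := bounded_linear_bound Bf.
have [N N0 gN] := bounded_linear_bound Bg.
have /bounded_linearP[lf _] := Bf; have /bounded_linearP[lg _] := Bg.
split=> [b x y|]; first by rewrite /= lg lf.
exists (M * N) => x; rewrite -mulrA (le_trans (fM _))//.
by rewrite ler_wpM2l.
Qed.

HB.instance Definition _ :=
  GRing.isSubmodClosed.Build K (X -> X) bounded_linear
    bounded_linear_submod_closed.

Record bounded_op := BoundedOp {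
  bop_fun :> X -> X;
  bop_funP : bop_fun \in bounded_linear
}.

HB.instance Definition _ := [isSub for bop_fun].
HB.instance Definition _ := [Choice of bounded_op by <:].
HB.instance Definition _ := [SubChoice_isSubLmodule of bounded_op by <:].

Lemma bop_addE (S T : bounded_op) x : (S + T) x = S x + T x.
Proof. by []. Qed.
Lemma bop_scaleE (k : K) (S : bounded_op) x : (k *: S) x = k *: S x.
Proof. by []. Qed.

Definition bop_one : bounded_op := BoundedOp bounded_linear_id.
Definition bop_mul (S T : bounded_op) : bounded_op :=
  BoundedOp (bounded_linear_comp (bop_funP S) (bop_funP T)).

Lemma bop_mulA : associative bop_mul.
Proof. by move=> S T U; apply: val_inj. Qed.
Lemma bop_mul1l : left_id bop_one bop_mul.
Proof. by move=> S; apply: val_inj. Qed.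
Lemma bop_mul1r : right_id bop_one bop_mul.
Proof. by move=> S; apply: val_inj. Qed.
Lemma bop_mulDl : left_distributive bop_mul +%R.
Proof. by move=> S T U; apply: val_inj; apply/funext. Qed.
Lemma bop_mulDr : right_distributive bop_mul +%R.
Proof.
move=> S T U; apply: val_inj; apply/funext => x.
have /bounded_linearP[lS _] := bop_funP S.
by have := lS 1 (T x) (U x); rewrite !scale1r.
Qed.

HB.instance Definition _ := GRing.Zmodule_isPzRing.Build bounded_op
  bop_mulA bop_mul1l bop_mul1r bop_mulDl bop_mulDr.

Lemma bop_mulE (S T : bounded_op) x : (S * T) x = S (T x).
Proof. by []. Qed.
Lemma bop_oneE x : (1 : bounded_op) x = x.
Proof. by []. Qed.

End BoundedOperators.

Section AlgebraMorphisms.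
Variables (K : numFieldType) (A : algType K) (X : normedModType K).

Definition algebra_isomorphism (Psi : A -> bounded_op X) : Prop :=
  [/\ linear Psi, bijective Psi, Psi 1 = 1
    & forall x y, Psi (x * y) = Psi x * Psi y].

Definition algebra_antiisomorphism (Psi : A -> bounded_op X) : Prop :=
  [/\ linear Psi, bijective Psi, Psi 1 = 1
    & forall x y, Psi (x * y) = Psi y * Psi x].

End AlgebraMorphisms.

(* Main.v *)
Require Import Defs.
From HB Require Import structures.
From mathcomp Require Import all_boot all_order all_algebra.
From mathcomp Require Import complex.
From mathcomp Require Import ring lra.
From mathcomp Require Import all_classical all_reals all_analysis.
Set Implicit Arguments.
Unset Strict Implicit.
Unset Printing Implicit Defensive.
Import Order.TTheory GRing.Theory Num.Theory.
Import numFieldNormedType.Exports.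
Local Open Scope classical_set_scope.
Local Open Scope ring_scope.

(* If a is invertible, then u <= a holds exactly when u a^-1 u = u.  Since Phi
   is injective and preserves the order, it preserves the minimal elements; on
   the side of B(X) these are the rank one operators.  A minimal u satisfies
   u x u = t(u, x) u with t(u, x) scalar, so comparing the minimal elements
   below a with those below Phi(a) gives t(Phi(u), Phi(a)^-1) = t(u, a^-1).
   Applied to a^-1 + (1 - a)^-1 = (a (1 - a))^-1 this yields
     Phi(a^2) = Phi(a) Phi(1)^-1 Phi(a),
   first when a and 1 - a are invertible, then for all a by translation.  Here
   inverses in B(X) are a priori only linear bijections of X, but if Phi(v) = 1
   then Phi(v^2) = Phi(1)^-1, so the latter is bounded without the open mapping
   theorem.  Hence
   Phi(1)^-1 Phi is a Jordan isomorphism onto the prime ring B(X), and by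
   Herstein's theorem an isomorphism or an anti-isomorphism. *)

(** * Minimal one-sided ideals and minimal elements of the minus order *)

Section MinimalElements.
Variable R : pzRingType.
Implicit Types (a b k l m n p q u v x y : R).

Definition semiprime := forall m, (forall k, m * k * m = 0) -> m = 0.

(** This expresses that R m is a minimal left ideal. *)
Definition left_minimal m :=
  m <> 0 /\ forall k, k * m <> 0 -> exists l, l * (k * m) = m.

Definition order_minimal m :=
  m <> 0 /\ forall v, minus_le v m -> v = 0 \/ v = m.

(** The form in which the essential socle is used: no nonzero element kills all minimal left ideals
    from the left. *)
Definition enough_minimal :=
  forall m, m <> 0 -> exists2 y, left_minimal y & m * y <> 0.

(** Since [1 - p] kills [p] from the left, it also kills [a], so [p] fixes [a]; symmetrically for
    [q]. *)
Lemma minus_le_eq a b : minus_le a b ->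
  exists p q, [/\ a = p * b, a = b * q, p * a = a & a * q = a].
Proof.
move=> [p [q [[pp qq] la ra pab aqb]]]; exists p, q.
have pa : p * a = a.
  have : ann_l p (1 - p) by rewrite /ann_l /= mulrBl mul1r pp subrr.
  by rewrite -la /ann_l /= mulrBl mul1r => /eqP; rewrite subr_eq0 => /eqP.
have aq : a * q = a.
  have : ann_r q (1 - q) by rewrite /ann_r /= mulrBr mulr1 qq subrr.
  by rewrite -ra /ann_r /= mulrBr mulr1 => /eqP; rewrite subr_eq0 => /eqP.
by split=> //; [rewrite -pab|rewrite -aqb].
Qed.

Lemma minus_le0 a : minus_le a 0 -> a = 0.
Proof. by move=> /minus_le_eq[p [q [-> _ _ _]]]; rewrite mulr0. Qed.

Lemma minus_0le b : minus_le 0 b.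
Proof.
exists 0, 0; split; rewrite ?mul0r ?mulr0 //.
by split; rewrite /idempotents /= mulr0.
Qed.

(** Right multiplication by [b * n] is injective on R n, because a nonzero element of the kernel
    would generate [n] and force n b n = 0. With c n b n = n, it sends (n b c - 1) n to 0. *)
Lemma left_minimal_regular n b : left_minimal n -> n * b * n <> 0 ->
  exists c, n * b * c * n = n.
Proof.
move=> [n0 nmin] nbn0.
have cancel y : y * n * (b * n) = 0 -> y * n = 0.
  move=> ybn; apply: contrapT => /nmin[l lyn]; apply: nbn0.
  rewrite -[X in X * b * n]lyn; move: ybn; rewrite -!mulrA => ->.
  by rewrite mulr0.
have [c cE] : exists c, c * (n * b * n) = n by apply: nmin.
exists c; suff /eqP : (n * b * c - 1) * n = 0.
  by rewrite mulrBl mul1r subr_eq0 => /eqP.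
apply: cancel; rewrite mulrBl mulrBl mul1r.
have -> : n * b * c * n * (b * n) = n * b * (c * (n * b * n)).
  by rewrite !mulrA.
by rewrite cE !mulrA subrr.
Qed.

Lemma left_minimal_mulr n k : left_minimal n -> n * k <> 0 ->
  left_minimal (n * k).
Proof.
move=> [n0 nmin] nk0; split=> // h hnk.
have [|l lE] := nmin h; first by move=> hn; apply: hnk; rewrite mulrA hn mul0r.
by exists l; rewrite !mulrA -(mulrA l) lE.
Qed.

Lemma left_minimal_mull n k : left_minimal n -> k * n <> 0 ->
  left_minimal (k * n).
Proof.
move=> [n0 nmin] nk0; split=> // h hnk.
have [|l lE] := nmin (h * k); first by rewrite -mulrA.
by exists (k * l); rewrite -mulrA (mulrA h) lE.
Qed.

Hypothesis R_semiprime : semiprime.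

Lemma semiprime_neq0 m : m <> 0 -> exists k, m * k * m <> 0.
Proof.
by move=> m0; apply: contrapT => /forallNP mkm; apply/m0/R_semiprime => k;
  exact: contrapT (mkm k).
Qed.

(** Minimality passes to the right ideal n R: semiprimeness gives [a] with n (k a) n nonzero, and
    regularity applies. *)
Lemma left_minimal_right n k : left_minimal n -> n * k <> 0 ->
  exists l, n * k * l = n.
Proof.
move=> nmin /semiprime_neq0[a nkank].
have [|c cE] := @left_minimal_regular n (k * a) nmin.
  by move=> e; apply: nkank; rewrite !mulrA in e *; rewrite e mul0r.
by exists (a * c * n); rewrite !mulrA in cE *.
Qed.

Lemma left_minimal_regular1 n : left_minimal n -> exists c, n * c * n = n.
Proof.
move=> nmin; have [k nkn] := semiprime_neq0 nmin.1.
by have [c cE] := left_minimal_regular nmin nkn; exists (k * c); rewrite mulrA.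
Qed.

(** A nonzero v below m is [m * q], so right minimality gives m = v l; then v = p m = p v l = v l =
    m. *)
Lemma left_minimal_order m : left_minimal m -> order_minimal m.
Proof.
move=> mmin; split=> [|v vm]; first exact: mmin.1.
have [->|v0] := pselect (v = 0); [by left|right].
have [p [q [vp vq pv _]]] := minus_le_eq vm.
have [|l lE] := @left_minimal_right m q mmin; first by rewrite -vq.
by rewrite vp -lE -vq mulrA pv.
Qed.

(* With n = m y and n r n = n, the element n r m lies below m. *)
Lemma order_minimal_factor m y : order_minimal m -> left_minimal y ->
  m * y <> 0 -> exists r, m = m * y * r * m.
Proof.
move=> [m0 mmin] ymin my0; have [y0 yl] := ymin.
have [r rE] := left_minimal_regular1 (left_minimal_mull ymin my0).
rewrite !mulrA in rE.
have [l lE] := yl _ my0.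
have yE : y * r * m * y = y.
  by rewrite -[in y * r]lE -[RHS]lE -[in RHS]rE !mulrA.
exists r; set T := m * y * r * m; suff /mmin[T0|//] : minus_le T m.
  by case: my0; rewrite -rE -/T T0 mul0r.
exists (m * y * r), (y * r * m); split=> //.
- by split; rewrite /idempotents /= !mulrA ?rE ?yE.
- apply/seteqP; split=> x; rewrite /ann_l /= => xT; last first.
    by rewrite /T mulrA xT mul0r.
  have -> : x * (m * y * r) = x * T * (y * r).
    by rewrite /T -[in LHS]rE !mulrA.
  by rewrite xT mul0r.
- apply/seteqP; split=> x; rewrite /ann_r /= => xT; last first.
    have -> : T * x = m * (y * r * m * x) by rewrite /T !mulrA.
    by rewrite xT mulr0.
  have -> : y * r * m * x = l * (T * x) by rewrite /T -[in LHS]lE !mulrA.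
  by rewrite xT mulr0.
- by rewrite /T !mulrA rE.
- have -> : T * (y * r * m) = m * (y * r * m * y) * r * m by rewrite /T !mulrA.
  by rewrite yE !mulrA.
Qed.

(** For a left-minimal [y] with m y nonzero, m = (m y) (r m) is a nonzero right multiple of the
    left-minimal m y. *)
Lemma order_minimal_left m : enough_minimal -> order_minimal m ->
  left_minimal m.
Proof.
move=> ess mmin; have [y ymin my0] := ess m mmin.1.
have [r mE] := order_minimal_factor mmin ymin my0.
have : left_minimal (m * y * (r * m)).
  apply: left_minimal_mulr; first exact: left_minimal_mull.
  by rewrite mulrA -mE; exact: mmin.1.
by rewrite mulrA -mE.
Qed.

(** Let e = u s be idempotent with e u = u. If (1 - e) r = 0, then r = e r lies in u R. Otherwise (1
    - e) (u + r) = (1 - e) r generates u + r, so u lies in R r and, being nonzero, generates r. *)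
Lemma left_minimal_add u r : left_minimal u -> left_minimal r ->
  u + r = 0 \/ left_minimal (u + r) ->
  (exists k, r = k * u) \/ (exists k, r = u * k).
Proof.
move=> umin rmin [/eqP|mmin].
  by rewrite addrC addr_eq0 => /eqP ->; left; exists (-1); rewrite mulN1r.
have [s sE] := left_minimal_regular1 umin.
have [/eqP|er0] := pselect ((1 - u * s) * r = 0).
  rewrite mulrBl mul1r subr_eq0 => /eqP ->.
  by right; exists (s * r); rewrite !mulrA.
left; have em : (1 - u * s) * (u + r) = (1 - u * s) * r.
  by rewrite mulrDr [X in X + _]mulrBl mul1r sE subrr add0r.
have [|l] := mmin.2 (1 - u * s); first by rewrite em.
rewrite em => lE; pose k := l * (1 - u * s) - 1.
have uE : u = k * r by rewrite /k mulrBl mul1r -mulrA lE addrK.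
have [|l' l'E] := rmin.2 k; first by rewrite -uE; exact: umin.1.
by exists l'; rewrite -uE in l'E.
Qed.

End MinimalElements.

(** * Radical, socle, and the minus order in the presence of units *)

Section IdealsAndInverses.
Variable R : pzRingType.
Implicit Types (a b k l m p q x y : R).

(* If m R m = 0 and m lies outside a maximal left ideal M, then 1 = b m + k with
   k in M, and (b m)^2 = 0 makes k invertible. *)
Lemma semisimple_semiprime : semisimple R -> semiprime R.
Proof.
move=> ss m mm; suff : jacobson_radical R m by rewrite ss.
move=> M [[M0 MD MM] MT Mmax]; apply: contrapT => Mm.
pose J := [set z | exists b k, M k /\ z = b * m + k].
have JI : left_ideal J.
  split.
  - by exists 0, 0; rewrite mul0r addr0.
  - move=> _ _ [b [k [Mk ->]]] [b' [k' [Mk' ->]]].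
    by exists (b + b'), (k + k'); split; [exact: MD|rewrite mulrDl addrACA].
  - move=> a _ [b [k [Mk ->]]]; exists (a * b), (a * k); split; first exact: MM.
    by rewrite mulrDr mulrA.
have MJ : M `<=` J by move=> k Mk; exists 0, k; rewrite mul0r add0r.
have [JM|JT] := Mmax J JI MJ.
  by apply: Mm; rewrite -JM; exists 1, 0; rewrite mul1r addr0.
have : J 1 by rewrite JT.
move=> [b [k [Mk /esym kE]]]; apply: MT; apply/seteqP; split=> // z _.
suff M1 : M 1 by rewrite -[z]mulr1; exact: MM.
have -> : 1 = (1 + b * m) * k :> R.
  have -> : k = 1 - b * m by rewrite -kE addrC addKr.
  rewrite mulrBr mulr1 mulrDl mul1r.
  by have := mm b; rewrite -!mulrA => ->; rewrite mulr0 addr0 addrK.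
exact: MM.
Qed.

(** A counterexample [m] would lie in the left annihilator J of the socle. Any v in both J and the
    socle satisfies v R v = 0, hence vanishes, which contradicts essentiality. *)
Lemma essential_socle_enough_minimal : semiprime R ->
  essential_ideal (socle R) -> enough_minimal R.
Proof.
move=> sp [[[S0 SD SM] SMr] _ Sess] m m0; apply: contrapT => noy.
pose J := [set x : R | forall s, socle R s -> x * s = 0].
have JI : two_sided_ideal J.
  split; first split.
  - by move=> s _; rewrite mul0r.
  - by move=> x y Jx Jy s Ss; rewrite mulrDl Jx// Jy// addr0.
  - by move=> a x Jx s Ss; rewrite -mulrA Jx// mulr0.
  - by move=> a x Jx s Ss; rewrite -mulrA Jx//; exact: SM.
have Jm : J m.
  move=> _ [s [sL ->]]; rewrite mulr_sumr big1_seq // => y /andP[_ /sL].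
  move=> [L [[L0 LD LM] Lnz Lmin] Ly]; apply: contrapT => my; apply: noy.
  (* A nonzero element [y] of a minimal left ideal L is left-minimal, because R k y = L whenever k y
     is nonzero. *)
  exists y => //; split=> [y0|k ky]; first by apply: my; rewrite y0 mulr0.
  pose I := [set z : R | exists l, z = l * (k * y)].
  have II : left_ideal I.
    split.
    - by exists 0; rewrite mul0r.
    - by move=> _ _ [l ->] [l' ->]; exists (l + l'); rewrite mulrDl.
    - by move=> a _ [l ->]; exists (a * l); rewrite mulrA.
  have [|I0|IL] := Lmin I II.
  - by move=> _ [l ->]; rewrite mulrA; exact: LM.
  - case: ky; suff : I (k * y) by rewrite I0.
    by exists 1; rewrite mul1r.
  - by have : I y by [rewrite IL]; move=> [l lE]; exists l.
case: (Sess J JI) => [J0|]; first by apply: m0; move: Jm; rewrite J0.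
apply/seteqP; split=> [v [Sv Jv]|_ ->]; last by split=> // s _; rewrite mul0r.
by apply: sp => k; rewrite -mulrA Jv//; exact: SM.
Qed.

Lemma minus_le_of_inverse a b k : b * a = 1 -> a * b = 1 -> k * b * k = k ->
  minus_le k a.
Proof.
move=> ba ab kbk; exists (k * b), (b * k).
split; rewrite /idempotents /=.
- by split; rewrite ?mulrA ?kbk // -!mulrA (mulrA k) kbk.
- apply/seteqP; split=> x; rewrite /ann_l /= mulrA => xk.
    by rewrite xk mul0r.
  by rewrite -kbk !mulrA xk mul0r.
- apply/seteqP; split=> x; rewrite /ann_r /= -mulrA => kx.
    by rewrite kx mulr0.
  by rewrite -kbk -!mulrA kx mulr0.
- by rewrite kbk -mulrA ba mulr1.
- by rewrite mulrA kbk mulrA ab mul1r.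
Qed.

Lemma minus_le_inverse a b k : a * b = 1 -> minus_le k a -> k * b * k = k.
Proof.
move=> ab /minus_le_eq[p [q [kpa _ pk _]]].
by rewrite [X in X * b]kpa -(mulrA p) ab mulr1.
Qed.

(** Multiplying by a unit on the left conjugates the left idempotent and leaves right annihilators
    unchanged. *)
Lemma minus_leMl c d a b : d * c = 1 -> c * d = 1 ->
  minus_le a b -> minus_le (c * a) (c * b).
Proof.
move=> dc cd [p [q [[pp qq] la ra pab aqb]]]; exists (c * p * d), q; split.
- split=> //; rewrite /idempotents /=.
  have -> : c * p * d * (c * p * d) = c * p * (d * c) * p * d.
    by rewrite !mulrA.
  by rewrite dc mulr1 -(mulrA c) pp.
- apply/seteqP; split=> x; rewrite /ann_l /=.
    rewrite mulrA => xca; have : ann_l a (x * c) by [].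
    by rewrite la /ann_l /= !mulrA => ->; rewrite mul0r.
  move=> xcpd; have : ann_l p (x * c).
    rewrite /ann_l /=; have -> : x * c * p = x * (c * p * d) * c.
      by rewrite !mulrA -(mulrA (x * c * p)) dc mulr1.
    by rewrite xcpd mul0r.
  by rewrite -la /ann_l /= mulrA.
- rewrite -ra; apply/seteqP; split=> x; rewrite /ann_r /=; last first.
    by rewrite -mulrA => ->; rewrite mulr0.
  by move=> cax; rewrite -[a]mul1r -dc -!(mulrA d) cax mulr0.
- have cpd z : c * p * d * (c * z) = c * (p * z).
    by rewrite mulrA -(mulrA _ d) dc mulr1 mulrA.
  by rewrite !cpd pab.
- by rewrite -mulrA aqb mulrA.
Qed.

End IdealsAndInverses.

(** * Invariance of the minus order under (anti-)isomorphisms *)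

Section MinusOrderMorphism.
Variables (R S : pzRingType) (f : R -> S) (g : S -> R).
Hypotheses (fK : cancel f g) (gK : cancel g f) (f0 : f 0 = 0).

Lemma minus_le_iso a b : {morph f : x y / x * y} ->
  minus_le a b -> minus_le (f a) (f b).
Proof.
move=> fM [p [q [[pp qq] la ra pab aqb]]].
have ann0 x y : f x * f y = 0 <-> x * y = 0.
  by rewrite -fM -f0; split=> [/(can_inj fK)|->].
exists (f p), (f q); split; rewrite -?fM ?pab ?aqb //.
- by split; rewrite /idempotents /= -fM ?pp ?qq.
- apply/seteqP; split=> x; rewrite -[x]gK /ann_l /= !ann0;
    by [rewrite -[_ * a = 0]/(ann_l a _) la
       |rewrite -[_ * p = 0]/(ann_l p _) -la].
- apply/seteqP; split=> x; rewrite -[x]gK /ann_r /= !ann0;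
    by [rewrite -[a * _ = 0]/(ann_r a _) ra
       |rewrite -[q * _ = 0]/(ann_r q _) -ra].
Qed.

(** Left and right annihilators are exchanged, so [p] and [q] swap roles. *)
Lemma minus_le_antiiso a b : (forall x y, f (x * y) = f y * f x) ->
  minus_le a b -> minus_le (f a) (f b).
Proof.
move=> fM [p [q [[pp qq] la ra pab aqb]]].
have ann0 x y : f x * f y = 0 <-> y * x = 0.
  by rewrite -fM -f0; split=> [/(can_inj fK)|->].
exists (f q), (f p); split; rewrite -?fM ?pab ?aqb //.
- by split; rewrite /idempotents /= -fM ?pp ?qq.
- apply/seteqP; split=> x; rewrite -[x]gK /ann_l /= !ann0;
    by [rewrite -[a * _ = 0]/(ann_r a _) ra
       |rewrite -[q * _ = 0]/(ann_r q _) -ra].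
- apply/seteqP; split=> x; rewrite -[x]gK /ann_r /= !ann0;
    by [rewrite -[_ * a = 0]/(ann_l a _) la
       |rewrite -[_ * p = 0]/(ann_l p _) -la].
Qed.

End MinusOrderMorphism.

(** If x is outside P and y outside Q, then x + y lies in neither. This globalizes the pointwise
    alternative for Jordan morphisms. *)
Lemma subgroup_cover (V : zmodType) (P Q : V -> Prop) :
  (forall x y, P x -> P y -> P (x - y)) ->
  (forall x y, Q x -> Q y -> Q (x - y)) ->
  (forall x, P x \/ Q x) -> (forall x, P x) \/ (forall x, Q x).
Proof.
move=> PB QB PQ.
have [|/existsNP[x Px]] := pselect (forall x, P x); first by left.
right=> y; apply: contrapT => Qy.
have [//|Qx] := PQ x; have [Py|//] := PQ y.
have [Pxy|Qxy] := PQ (x + y).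
  by apply: Px; rewrite -[x](addrK y); exact: PB.
by apply: Qy; rewrite -[y](addKr x) addrC; exact: QB.
Qed.

(** * Herstein's theorem on Jordan morphisms onto prime rings *)

Section JordanMorphisms.
Variables (A B : pzRingType) (f : {additive A -> B}).
Hypothesis f_surj : forall y, exists x, f x = y.
Hypothesis fJ : forall x, f (x * x) = f x * f x.
Hypothesis B_torsion : forall y : B, y + y = 0 -> y = 0.
Hypothesis B_prime :
  forall a b : B, (forall r, a * r * b = 0) -> a = 0 \/ b = 0.

Lemma jordanD a b : f (a * b + b * a) = f a * f b + f b * f a.
Proof.
have := fJ (a + b); rewrite raddfD !mulrDl !mulrDr !raddfD !fJ -!addrA.
by move=> /addrI; rewrite !addrA => /addIr.
Qed.

Lemma double_inj (x y : B) : x + x = y + y -> x = y.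
Proof.
move=> xy; apply/eqP; rewrite -subr_eq0; apply/eqP/B_torsion.
by rewrite addrACA xy -opprD subrr.
Qed.

(** Twice a b a is a combination of Jordan products, and 2 can be cancelled. *)
Lemma jordan_triple a b : f (a * b * a) = f a * f b * f a.
Proof.
have tw (R : pzRingType) (x y : R) :
    x * y * x + x * y * x =
    x * (x * y + y * x) + (x * y + y * x) * x - (x * x * y + y * (x * x)).
  by rewrite mulrDr mulrDl !mulrA (addrC (x * x * y)) addrACA addrK.
apply: double_inj.
by rewrite -raddfD !tw raddfB !jordanD fJ.
Qed.

Lemma jordan_triple2 a b c :
  f (a * b * c + c * b * a) = f a * f b * f c + f c * f b * f a.
Proof.
have := jordan_triple (a + c) b.
rewrite raddfD !mulrDl !mulrDr !raddfD !jordan_triple -!addrA.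
by move=> /addrI; rewrite !addrA => /addIr.
Qed.

(** Swapping twice gives v r u s u = u r u s v, while the hypothesis at r u s makes their sum zero;
    so u r u s v = 0, and primeness is used twice. *)
Lemma anticommuting_prime (u v : B) :
  (forall r, u * r * v + v * r * u = 0) -> u = 0 \/ v = 0.
Proof.
move=> uv; have swap r : v * r * u = - (u * r * v).
  by apply/eqP; rewrite -addr_eq0 addrC uv.
have urusv r s : u * r * u * s * v = 0.
  apply: B_torsion; have := uv (r * u * s); rewrite !mulrA.
  have -> : v * r * u * s * u = u * r * u * s * v.
    by rewrite swap mulNr mulNr -!(mulrA (u * r)) swap mulrN opprK !mulrA.
  by [].
have [v0|v0] := pselect (v = 0); [by right|left].
suff uru : forall r, u * r * u = 0 by case: (B_prime uru).
by move=> r; case: (B_prime (urusv r)).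
Qed.

(** It suffices that (Z - P) r (Z - Q) + (Z - Q) r (Z - P) = 0 for all r. The input is Z + W = P + Q
    together with the image of a (b r b) a + b (a r a) b, computed in two ways. *)
Lemma jordan_dichotomy a b :
  f (a * b) = f a * f b \/ f (a * b) = f b * f a.
Proof.
set Z := f (a * b); set P := f a * f b; set Q := f b * f a.
suff : Z - P = 0 \/ Z - Q = 0.
  by case=> /eqP; rewrite subr_eq0 => /eqP; [left|right].
apply: anticommuting_prime => y; have [r <-] := f_surj y.
pose W := f (b * a); have ZW : Z + W = P + Q by rewrite -raddfD jordanD.
have ZrW : Z * f r * W + W * f r * Z = P * f r * Q + Q * f r * P.
  rewrite -jordan_triple2.
  have -> : a * b * r * (b * a) + b * a * r * (a * b) =
            a * (b * r * b) * a + b * (a * r * a) * b by rewrite !mulrA.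
  by rewrite raddfD !jordan_triple !mulrA.
have ZQ : Z - Q = P - W.
  by apply/eqP; rewrite subr_eq addrAC eq_sym subr_eq ZW.
(* Only the [Z - Q] multiplied by [Z] becomes [P - W]; the terms Z r P and P r Z then cancel in the
   sum. *)
have e1 : (Z - P) * f r * (Z - Q) =
    Z * f r * P - Z * f r * W - (P * f r * Z - P * f r * Q).
  by rewrite (mulrBl (f r) Z P) mulrBl {1}ZQ !mulrBr.
have e2 : (Z - Q) * f r * (Z - P) =
    P * f r * Z - W * f r * Z - (Z * f r * P - Q * f r * P).
  by rewrite (mulrBr _ Z P) {1}ZQ !mulrBl.
have zmodE (V : zmodType) (x1 x2 x3 x4 x5 x6 : V) :
    x1 - x2 - (x3 - x4) + (x3 - x5 - (x1 - x6)) = x4 + x6 - (x2 + x5).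
  rewrite addrACA -opprD addrACA -opprD [x3 - x4 + _]addrACA -opprD opprB.
  by rewrite addrC (addrC x3) addrA subrK.
by rewrite e1 e2 zmodE -ZrW subrr.
Qed.

(** For fixed a, the b satisfying either product rule form a subgroup, and the two subgroups cover
    the ring; the same argument is then run in a. *)
Theorem jordan_hom_or_antihom :
  (forall x y, f (x * y) = f x * f y) \/ (forall x y, f (x * y) = f y * f x).
Proof.
have homB a b b' : f (a * b) = f a * f b -> f (a * b') = f a * f b' ->
    f (a * (b - b')) = f a * f (b - b').
  by rewrite mulrBr !raddfB mulrBr => -> ->.
have antiB a b b' : f (a * b) = f b * f a -> f (a * b') = f b' * f a ->
    f (a * (b - b')) = f (b - b') * f a.
  by rewrite mulrBr !raddfB mulrBl => -> ->.
apply: subgroup_cover => [x x' hx hx' y|x x' hx hx' y|x].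
- by rewrite mulrBl !raddfB mulrBl hx hx'.
- by rewrite mulrBl !raddfB mulrBr hx hx'.
- apply: subgroup_cover => [y y'|y y'|y]; [exact: homB|exact: antiB|].
  exact: jordan_dichotomy.
Qed.

End JordanMorphisms.

(** * Sublinear functionals and real Hahn-Banach domination *)

Section Sublinear.
Variables (R : realType) (V : lmodType R[i]).
Implicit Types (p q : V -> R) (x y z : V).
Local Open Scope complex_scope.

(** The complex space is viewed as a real one. Homogeneity is only an inequality, which is easier to
    check for infima; using t^-1 as well gives equality. *)
Definition sublinear p :=
  (forall x y, p (x + y) <= p x + p y) /\
  (forall (t : R) x, 0 < t -> p (t%:C *: x) <= t * p x).

Lemma sublinearZ p t x : sublinear p -> 0 < t -> p (t%:C *: x) = t * p x.
Proof.
move=> [_ pZ] t0; apply/eqP; rewrite eq_le pZ//= -ler_pdivlMl//.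
have tC0 : t%:C != 0 by rewrite (inj_eq (@complexI R)) gt_eqF.
rewrite -[x in leLHS](scalerK tC0) -fmorphV.
by apply: pZ; rewrite invr_gt0.
Qed.

Lemma sublinear0 p : sublinear p -> p 0 = 0.
Proof.
move=> sp; have := sublinearZ 0 sp (ltr0n R 2); rewrite scaler0; lra.
Qed.

Lemma sublinear_geN p x : sublinear p -> - p (- x) <= p x.
Proof.
move=> sp; have := sp.1 x (- x); rewrite subrr sublinear0//; lra.
Qed.

(** Used for directional infima and for lower bounds of chains; the index [k] may depend on the
    points. *)
Lemma sublinear_inf (I : Type) (D : set I) (g : I -> V -> R) :
  D !=set0 ->
  (forall i j x y, D i -> D j ->
     exists2 k, D k & g k (x + y) <= g i x + g j y) ->
  (forall t i x, 0 < t -> D i ->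
     exists2 k, D k & g k (t%:C *: x) <= t * g i x) ->
  (forall x, exists m, forall i, D i -> m <= g i x) ->
  let p x := inf [set g i x | i in D] in
  sublinear p /\ forall i x, D i -> p x <= g i x.
Proof.
move=> [i0 Di0] gD gZ glb p.
have ple i x : D i -> p x <= g i x.
  move=> Di; apply: ge_inf; last by exists i.
  by have [m mP] := glb x; exists m => _ [j Dj <-]; exact: mP.
have lep m x : (forall i, D i -> m <= g i x) -> m <= p x.
  move=> mP; apply: lb_le_inf; first by exists (g i0 x), i0.
  by move=> _ [j Dj <-]; exact: mP.
split=> //; split=> [x y|t x t0].
  rewrite -lerBlDr; apply: (lep) => i Di; rewrite lerBlDr -lerBlDl.
  apply: (lep) => j Dj; rewrite lerBlDl.
  by have [k Dk] := gD i j x y Di Dj; apply: le_trans; exact: ple.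
rewrite -ler_pdivrMl//; apply: (lep) => i Di; rewrite ler_pdivrMl//.
by have [k Dk] := gZ t i x t0 Di; apply: le_trans; exact: ple.
Qed.

(* The directional infimum of x |-> p (x + t z) - t p z over t >= 0 stays
   sublinear, so a minimal sublinear functional is additive. *)
Lemma sublinear_directional p z : sublinear p ->
  exists q, [/\ sublinear q, forall x, q x <= p x
    & forall x, q x <= p (x + z) - p z].
Proof.
move=> sp; pose g (t : R) x := p (x + t%:C *: z) - t * p z.
have pz t : 0 <= t -> p (t%:C *: z) = t * p z.
  rewrite le_eqVlt => /predU1P[<-|t0]; last exact: sublinearZ.
  by rewrite scale0r mul0r sublinear0.
have [||||sq qg] := @sublinear_inf R [set t | 0 <= t] g.
- by exists 0 => /=.
- move=> s t x y /= s0 t0; exists (s + t); first exact: addr_ge0.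
  have := sp.1 (x + s%:C *: z) (y + t%:C *: z).
  by rewrite addrACA -scalerDl -raddfD /= /g mulrDl; lra.
- move=> t s x t0 /= s0; exists (t * s); first exact: (mulr_ge0 (ltW t0)).
  rewrite /g rmorphM -scalerA -scalerDr sublinearZ// -mulrA -mulrBr.
  exact: lexx.
- move=> x; exists (- p (- x)) => t /= t0; rewrite /g.
  have := sp.1 (- x) (x + t%:C *: z); rewrite addKr pz//; lra.
exists (fun x => inf [set g t x | t in [set t | 0 <= t]]); split=> // x.
  by have := qg 0 x (lexx 0); rewrite /g scale0r addr0 mul0r subr0.
by have := qg 1 x ler01; rewrite /g scale1r mul1r.
Qed.

(** Zorn's lemma for the reversed pointwise order: a nonempty chain has its infimum as bound, finite
    because each member is at least - p (- x) at x. *)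
Lemma minimal_sublinear p : sublinear p -> exists q,
  [/\ sublinear q, forall x, q x <= p x
    & forall r, sublinear r -> (forall x, r x <= q x) -> r = q].
Proof.
move=> sp; pose T := {q : V -> R | sublinear q /\ forall x, q x <= p x}.
pose Rel (q r : T) := `[< forall x, sval r x <= sval q x >].
have [||||[q [sq qp]] qmin] := @Zorn T Rel.
- by move=> q; apply/asboolP.
- move=> q r s /asboolP qr /asboolP rs; apply/asboolP => x.
  exact: le_trans (rs x) (qr x).
- move=> [q hq] [r hr] /asboolP/= qr /asboolP/= rq; apply/eq_exist/funext => x.
  by apply/eqP; rewrite eq_le qr rq.
- move=> D Dtot; have [[q0 Dq0]|D0] := pselect (D !=set0); last first.
    by exists (exist _ p (conj sp (fun=> lexx _))) => s Ds; case: D0; exists s.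
  have Dmin (q r : T) : D q -> D r ->
      exists2 s : T, D s &
        forall x, sval s x <= sval q x /\ sval s x <= sval r x.
    move=> Dq Dr; have [/asboolP qr|/asboolP rq] := Dtot q r Dq Dr.
      by exists r.
    by exists q.
  have [||||sq qD] := @sublinear_inf T D (fun s : T => sval s).
  - by exists q0.
  - move=> q r x y Dq Dr; have [s Ds sqr] := Dmin q r Dq Dr; exists s => //.
    have [ss _] := svalP s; apply: le_trans (ss.1 x y) _.
    by apply: lerD; [exact: (sqr x).1|exact: (sqr y).2].
  - move=> t q x t0 Dq; exists q => //; have [ss _] := svalP q.
    exact: ss.2.
  - move=> x; exists (- p (- x)) => q Dq; have [ss qp] := svalP q.
    by apply: le_trans (sublinear_geN x ss); rewrite lerN2.
  set q := (fun x => _) in sq qD.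
  have qp : forall x, q x <= p x.
    by move=> x; apply: le_trans (qD q0 x Dq0) _; exact: (svalP q0).2.
  by exists (exist _ q (conj sq qp)) => s Ds; apply/asboolP => x; exact: qD.
exists q; split=> // r sr rq.
have rp x : r x <= p x := le_trans (rq x) (qp x).
have /= := qmin (exist _ r (conj sr rp)).
by move=> H; have /(congr1 sval) := H (introT (asboolP _) rq).
Qed.

(** First pass to [p0] below [p] with p0 (- y) <= - p y, then to a minimal [f] below [p0].
    Minimality turns the directional bound into f x <= f (x + z) - f z, hence additivity, and f (-
    y) <= - p y gives the value at [y]. *)
Lemma sublinear_dominated p y : sublinear p -> exists f : V -> R,
  [/\ {morph f : x z / x + z >-> x + z},
      forall t x, f (t%:C *: x) = t * f x,
      forall x, f x <= p x & p y <= f y].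
Proof.
move=> sp; have [p0 [sp0 p0p p0y]] := sublinear_directional y sp.
have [f [sf fp0 fmin]] := minimal_sublinear sp0.
have fD : {morph f : x z / x + z >-> x + z}.
  move=> x z; apply/eqP; rewrite eq_le sf.1 /=.
  have [q [sq qf qz]] := sublinear_directional z sf.
  by rewrite -lerBrDr; apply: le_trans (qz x); rewrite (fmin q).
have f0 := sublinear0 sf.
have fN x : f (- x) = - f x.
  by apply/eqP; rewrite -addr_eq0 -fD addNr f0.
exists f; split=> // [t x|x|]; last 2 first.
- exact: le_trans (fp0 x) (p0p x).
- rewrite -[leRHS]opprK -fN; have := fp0 (- y); have := p0y (- y).
  by rewrite addNr (sublinear0 sp); lra.
have [t0|t0|<-] := ltgtP 0 t; [exact: sublinearZ| |].
  rewrite -[t]opprK rmorphN scaleNr fN sublinearZ ?oppr_gt0// opprK.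
  by rewrite mulNr opprK.
by rewrite scale0r f0 mul0r.
Qed.

End Sublinear.

(** * Complex Hahn-Banach separation *)

Section BoundedFunctionals.
Variables (R : realType) (X : normedModType R[i]).
Implicit Types (x y z : X).
Local Open Scope complex_scope.

Definition bounded_functional (f : X -> R[i]) :=
  scalar f /\ exists M : R[i], forall x, `|f x| <= M * `|x|.

Lemma norm_realC x : `|x| = (complex.Re `|x|)%:C.
Proof. by rewrite RRe_real// normr_real. Qed.

(** A real functional f below the norm with f y >= |y| yields the complex linear F x = f x - i f (i
    x), nonzero at [y] and bounded by twice the norm; it is then rescaled. *)
Lemma hahn_banach y : y != 0 -> exists2 f, bounded_functional f & f y = 1.
Proof.
move=> y0; pose p x := complex.Re `|x|.
have sp : sublinear p.
  split=> [x z|t x t0]; rewrite /p.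
    by rewrite -lecR rmorphD /= -!norm_realC ler_normD.
  rewrite -lecR rmorphM/= -!norm_realC normrZ.
  by rewrite ger0_norm// ler0c ltW.
have [f [fD fZ fp py]] := sublinear_dominated y sp.
have f0 : f 0 = 0 by have := fZ 0 0; rewrite scaler0 mul0r.
have fN x : f (- x) = - f x.
  by apply/eqP; rewrite -addr_eq0 -fD addNr f0.
pose F x : R[i] := f x -i* f ('i *: x).
have iZi x : 'i *: ('i *: x) = - x by rewrite scalerA -expr2 sqr_i scaleN1r.
have FD : {morph F : x z / x + z}.
  by move=> x z; rewrite /F scalerDr !fD opprD.
have FZ c x : F (c *: x) = c * F x.
  case: c => a b; have -> : (a +i* b) *: x = a%:C *: x + b%:C *: ('i *: x).
    rewrite scalerA -scalerDl; congr (_ *: _); simpc.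
    by rewrite ?mulr0 ?mulr1 ?addr0 ?add0r ?subr0.
  rewrite /F scalerDr !scalerA -[_ * a%:C]mulrC -[_ * (b%:C * _)]mulrCA.
  rewrite -!scalerA.
  rewrite !fD !fZ iZi fN; simpc; congr (_ +i* _); lra.
have abs_f x : `|f x| <= p x.
  by rewrite ler_norml fp andbT lerNl -fN (le_trans (fp _))// /p normrN.
have Fb x : `|F x| <= 2 * `|x|.
  have -> : F x = (f x)%:C - 'i * (f ('i *: x))%:C.
    rewrite /F; simpc; congr (_ +i* _); lra.
  apply: (le_trans (ler_normB _ _)); rewrite normrM.
  have normR (t : R) : `|t%:C| = `|t|%:C.
    by rewrite normc_def /= expr0n addr0 sqrtr_sqr.
  have -> : `|'i : R[i]| = 1.
    by rewrite normc_def /= expr0n add0r expr1n sqrtr1.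
  rewrite mul1r !normR mulr_natl mulr2n lerD// norm_realC lecR //.
  apply: (le_trans (abs_f _)); rewrite /p normrZ.
  have -> : `|'i : R[i]| = 1.
    by rewrite normc_def /= expr0n add0r expr1n sqrtr1.
  by rewrite mul1r.
have Fy0 : F y != 0.
  apply/eqP => /(congr1 (@complex.Re R)) /= fy0; move: py; rewrite fy0 /p => py.
  move: (y0); rewrite -normr_gt0 norm_realC -[0]/(0%:C) ltcR => /lt_le_trans.
  by move=> /(_ _ py); rewrite ltxx.
exists (fun x => (F y)^-1 * F x); last by rewrite mulVf.
split=> [c x z|]; first by rewrite FD FZ mulrDr mulrCA.
exists (`|(F y)^-1| * 2) => x; rewrite normrM -mulrA.
by rewrite ler_wpM2l.
Qed.

End BoundedFunctionals.

(** * Neumann series in a Banach algebra *)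

Section Neumann.
Variables (R : realType) (A : banachAlgType R[i]).
Implicit Types (x y z : A).

Lemma geometric_small (c e : R[i]) : 0 <= c -> 0 < e ->
  exists N, forall n, (N <= n)%N -> c * 2^-1 ^+ n < e.
Proof.
move=> c0 e0; pose t := e^-1 * c.
have t0 : 0 <= t by rewrite mulr_ge0// invr_ge0 ltW.
have tR : t = (complex.Re t)%:C%C by rewrite RRe_real// ger0_real.
exists (Num.bound (complex.Re t)) => n Nn.
have tn : t < n%:R.
  rewrite tR -(rmorph_nat (real_complex R)) ltcR.
  apply: (lt_le_trans (archi_boundP _)); last by rewrite ler_nat.
  by rewrite -ler0c -tR.
have n2 : n%:R < 2 ^+ n :> R[i] by rewrite -natrX ltr_nat ltn_expl.
rewrite exprVn ltr_pdivrMr ?exprn_gt0// -ltr_pdivrMl//.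
exact: lt_trans tn n2.
Qed.

(** The factor [|1|] appears because the unit need not have norm one. *)
Lemma banach_normX x n : `|x| <= 2^-1 -> `|x ^+ n| <= `|1 : A| * 2^-1 ^+ n.
Proof.
move=> x2; elim: n => [|n IHn]; first by rewrite !expr0 mulr1.
rewrite exprS (le_trans (banach_normM _ _))// exprS mulrCA.
by rewrite ler_pM.
Qed.

Lemma neumann_inverse x : `|x| <= 2^-1 ->
  exists b, b * (1 - x) = 1 /\ (1 - x) * b = 1.
Proof.
move=> x2; pose s n : A := \sum_(i < n) x ^+ i.
have sE n : (1 - x) * s n = 1 - x ^+ n.
  by rewrite -[RHS]opprB subrX1 -mulNr opprB.
have sC n : s n * (1 - x) = 1 - x ^+ n.
  rewrite -sE mulr_sumr mulr_suml; apply: eq_bigr => i _.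
  by rewrite mulrBl mulrBr mulr1 mul1r -exprS -exprSr.
have sbnd n : `|s n| <= `|1 : A| * 2 * (1 - 2^-1 ^+ n).
  elim: n => [|n IHn]; first by rewrite /s big_ord0 normr0 expr0 subrr mulr0.
  rewrite /s big_ord_recr/= -/(s n) (le_trans (ler_normD _ _))//.
  apply: (le_trans (lerD IHn (banach_normX n x2))).
  by rewrite le_eqVlt; apply/orP; left; apply/eqP; rewrite exprS; field.
have shift n k : s (n + k)%N = s n + x ^+ n * s k.
  rewrite /s big_split_ord/= mulr_sumr; congr (_ + _).
  by apply: eq_bigr => i _; rewrite exprD.
have cauchy_s : cauchy (s @ \oo).
  apply: cauchy_exP => e e0.
  (* The tail s (N + k) - s N is x^N s k: one factor [|1|] bounds x^N, and [|1| * 2] bounds every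
     partial sum. *)
  have [|N NP] := @geometric_small (`|1 : A| * (`|1 : A| * 2)) e _ e0.
    by rewrite !mulr_ge0.
  exists (s N); exists N => // n /= Nn; rewrite -ball_normE /ball_/=.
  rewrite -(subnKC Nn) shift opprD addNKr normrN.
  apply: le_lt_trans (NP N (leqnn _)).
  apply: (le_trans (banach_normM _ _)); rewrite mulrAC.
  apply: ler_pM => //; first exact: banach_normX.
  apply: (le_trans (sbnd _)); rewrite ler_piMr//.
have /cauchy_cvgP/cvg_ex[b sb] := cauchy_s.
have near_b e : 0 < e -> exists n, `|b - s n| < e /\ `|1 : A| * 2^-1 ^+ n < e.
  move=> e0; move/cvgrPdist_lt : sb => /(_ e e0)[N _ NP].
  have [M MP] := @geometric_small `|1 : A| e (normr_ge0 _) e0.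
  exists (maxn N M); split; last by apply: MP; rewrite leq_maxr.
  by apply: NP; rewrite /= leq_maxl.
(* One limit argument serves for the left and the right product with 1 - x. *)
have eq1 (op : A -> A) :
    (forall n, `|op b - op (s n)| <= `|1 - x| * `|b - s n|) ->
    (forall n, op (s n) = 1 - x ^+ n) -> op b = 1.
  move=> opB ops; apply/eqP; rewrite -subr_eq0; apply/negPn/negP.
  rewrite -normr_gt0 => d0; pose e := `|op b - 1| / (`|1 - x| + 1).
  have l0 : 0 < `|1 - x| + 1 by rewrite ltr_wpDl.
  have [n [bn xn]] := near_b e (divr_gt0 d0 l0).
  have : `|op b - 1| < `|op b - 1|; last by rewrite ltxx.
  have {1}-> : op b - 1 = (op b - op (s n)) - x ^+ n.
    by rewrite ops opprB addrCA addrAC subrr add0r.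
  apply: (le_lt_trans (ler_normB _ _)).
  have -> : `|op b - 1| = (`|1 - x| + 1) * e by rewrite mulrC divfK// gt_eqF.
  rewrite mulrDl mul1r.
  apply: ler_ltD; last exact: le_lt_trans (banach_normX n x2) xn.
  by apply: (le_trans (opB n)); rewrite ler_wpM2l// ltW.
exists b; split; [apply: (eq1 (fun y => y * (1 - x))) => //= n
                |apply: (eq1 (fun y => (1 - x) * y)) => //= n].
  by rewrite -mulrBl mulrC banach_normM.
by rewrite -mulrBr banach_normM.
Qed.

(** With M = 2 |x| the Neumann series inverts 1 - x / t. The condition on [t] being nonzero is
    separate because M is 0 when x is. *)
Lemma shift_invertible x : exists2 M : R[i], 0 <= M &
  forall t : R[i], M <= `|t| -> t != 0 ->
  exists b, b * (x - t%:A) = 1 /\ (x - t%:A) * b = 1.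
Proof.
exists (2 * `|x|) => [|t tM t0]; first by rewrite mulr_ge0.
have [|b [b1 b2]] := @neumann_inverse (t^-1 *: x).
  rewrite normrZ normfV ler_pdivrMl ?normr_gt0//.
  by rewrite mulrC -ler_pdivrMl ?invr_gt0// invrK.
have xE : x - t%:A = (- t) *: (1 - t^-1 *: x).
  by rewrite scalerBr scalerA mulNr mulfV// !scaleNr opprK scale1r addrC.
exists ((- t)^-1 *: b); rewrite xE; split.
  by rewrite -scalerAl -scalerAr scalerA b1 mulVf ?oppr_eq0// scale1r.
by rewrite -scalerAl -scalerAr scalerA b2 mulfV ?oppr_eq0// scale1r.
Qed.

End Neumann.

(** * Linear algebra of rank one maps *)

Section RankOne.
Variables (K : fieldType) (V : lmodType K).
Implicit Types (x y z w p : V) (f g h : V -> K).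

Lemma scalar_functional f : scalar f ->
  [/\ f 0 = 0, forall x y, f (x + y) = f x + f y,
      forall x y, f (x - y) = f x - f y & forall c x, f (c *: x) = c * f x].
Proof.
move=> lf; have fD x y : f (x + y) = f x + f y.
  by have := lf 1 x y; rewrite scale1r mul1r.
have f0 : f 0 = 0 by apply: (addIr (f 0)); rewrite -fD !add0r.
have fZ c x : f (c *: x) = c * f x.
  by have := lf c x 0; rewrite !addr0 f0 addr0.
by split=> // x y; rewrite fD -scaleN1r fZ mulN1r.
Qed.

Lemma scalar_proportional f g : scalar f -> scalar g ->
  (forall z, f z = 0 -> g z = 0) -> exists c, forall z, g z = c * f z.
Proof.
move=> /scalar_functional[f0 _ fB fZ] /scalar_functional[g0 _ gB gZ] fg.
have [[z0 fz0]|nof] := pselect (exists z, f z != 0); last first.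
  exists 0 => z; rewrite mul0r fg//; apply/eqP/negPn/negP => fz.
  by apply: nof; exists z.
exists (g z0 / f z0) => z; pose w := z - (f z / f z0) *: z0.
have /fg : f w = 0 by rewrite fB fZ divfK// subrr.
rewrite gB gZ => /eqP; rewrite subr_eq0 => /eqP ->.
by rewrite mulrC mulrA mulrAC.
Qed.

(** If g is no multiple of f, some z has f z = 0 and g z nonzero. Evaluation at z puts p on the line
    of y, and evaluation at [z0] then puts x there. *)
Lemma rank_one_sum x y p f g h : scalar f -> scalar g ->
  (forall z, f z *: x + g z *: y = h z *: p) ->
  x != 0 -> (exists z, f z != 0) ->
  (exists c, forall z, g z = c * f z) \/ (exists c, y = c *: x).
Proof.
move=> lf lg fgh x0 [z0 fz0].
have [/(scalar_proportional lf lg)|] := pselect (forall z, f z = 0 -> g z = 0).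
  by left.
move=> /existsNP[z /not_implyP[fz /eqP gz]]; right.
have [->|y0] := eqVneq y 0; first by exists 0; rewrite scale0r.
have := fgh z; rewrite fz scale0r add0r => yp.
have hz : h z != 0.
  apply: contra y0 => /eqP hz; move: yp; rewrite hz scale0r => /eqP.
  by rewrite scaler_eq0 (negPf gz).
have pE : p = (g z / h z) *: y by rewrite mulrC -scalerA yp scalerK.
have := fgh z0; rewrite pE scalerA => /eqP.
rewrite -subr_eq0 -addrA -scalerBl addr_eq0 -scaleNr.
set c := - _ => /eqP fx; have c0 : c != 0.
  apply: contraNneq x0 => c0; move: fx => /eqP.
  by rewrite c0 scale0r scaler_eq0 (negPf fz0).
by exists (c^-1 * f z0); rewrite -scalerA fx scalerK.
Qed.

End RankOne.

(** * Primeness of B(X) and its minimal elements *)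

Section BoundedOperatorAlgebra.
Variables (R : realType) (X : normedModType R[i]).
Implicit Types (S T : bounded_op X) (x y z : X) (f g : X -> R[i]).

Lemma bop_linear S : linear S.
Proof. by have /bounded_linearP[] := bop_funP S. Qed.

Lemma bopD S x y : S (x + y) = S x + S y.
Proof. by have := bop_linear S 1 x y; rewrite !scale1r. Qed.

Lemma bop0 S : S 0 = 0.
Proof. by apply: (addIr (S 0)); rewrite -bopD !add0r. Qed.

Lemma bopZ S c x : S (c *: x) = c *: S x.
Proof. by have := bop_linear S c x 0; rewrite bop0 !addr0. Qed.

Lemma bopB S x y : S (x - y) = S x - S y.
Proof. by rewrite bopD -scaleN1r bopZ scaleN1r. Qed.

Lemma bop_subE S T x : (S - T) x = S x - T x.
Proof. by []. Qed.

Lemma bopP S T : (forall x, S x = T x) -> S = T.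
Proof. by move=> ST; apply/val_inj/funext. Qed.

Lemma bounded_functional_comp f S :
  bounded_functional f -> bounded_functional (f \o S).
Proof.
move=> [lf [M fM]]; split=> [c x y|].
  by rewrite /= bop_linear lf.
have [N N0 SN] := bounded_linear_bound (bop_funP S).
exists (`|M| * N) => x; rewrite /= (le_trans (fM _))//.
rewrite -(ger0_norm (le_trans (normr_ge0 _) (fM (S x)))) normrM normr_id.
by rewrite -mulrA ler_wpM2l.
Qed.

Lemma bounded_functionalZ c f :
  bounded_functional f -> bounded_functional (fun x => c * f x).
Proof.
move=> [lf [M fM]]; split=> [d x y|]; first by rewrite lf mulrDr mulrCA.
by exists (`|c| * M) => x; rewrite normrM -mulrA ler_wpM2l.
Qed.

Lemma bounded_functionalD f g : bounded_functional f -> bounded_functional g ->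
  bounded_functional (fun x => f x + g x).
Proof.
move=> [lf [M fM]] [lg [N gN]]; split=> [d x y|].
  by rewrite lf lg mulrDr addrACA.
exists (M + N) => x; rewrite mulrDl (le_trans (ler_normD _ _))//.
exact: lerD.
Qed.

Definition at_most_rank_one S := exists x f, bounded_functional f /\
  forall z, S z = f z *: x.

Lemma rank_one_exists x f : bounded_functional f ->
  exists S, forall z, S z = f z *: x.
Proof.
move=> [lf [M fM]]; suff bS : (fun z => f z *: x) \in @bounded_linear R[i] X.
  by exists (BoundedOp bS).
apply/bounded_linearP; split=> [c y z|].
  by rewrite lf scalerDl scalerA.
by exists (M * `|x|) => z; rewrite normrZ mulrAC ler_wpM2r.
Qed.

Lemma bop_neq0 S : S <> 0 -> exists x, S x != 0.
Proof.
move=> S0; apply: contrapT => /forallNP Sx; apply/S0/bopP => x.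
by apply/eqP/negPn/negP; exact: Sx.
Qed.

(** If T y is nonzero, a rank one U sends it to any prescribed x, so S x = 0. *)
Lemma bop_prime S T : (forall U, S * U * T = 0) -> S = 0 \/ T = 0.
Proof.
move=> SUT; have [->|/bop_neq0[y Ty]] := pselect (T = 0); [by right|left].
apply: bopP => x; have [f bf fTy] := hahn_banach Ty.
have [U UE] := rank_one_exists x bf.
have : (S * U * T) y = 0 by rewrite SUT.
by rewrite !bop_mulE UE fTy scale1r.
Qed.

Lemma bop_semiprime : semiprime (bounded_op X).
Proof. by move=> S /bop_prime[]. Qed.

Lemma functional_separates x : (forall f, bounded_functional f -> f x = 0) ->
  x = 0.
Proof.
move=> fx; apply/eqP/negPn/negP => /hahn_banach[f /fx ->] /eqP.
by rewrite eq_sym oner_eq0.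
Qed.

Lemma rank_one_left_minimal S : at_most_rank_one S -> S <> 0 ->
  left_minimal S.
Proof.
move=> [x [f [bf SE]]] S0; split=> // T TS0.
have Tx : T x != 0.
  apply: contra_notN TS0 => /eqP Tx; apply: bopP => z.
  by rewrite bop_mulE SE bopZ Tx scaler0.
have [g bg gTx] := hahn_banach Tx; have [U UE] := rank_one_exists x bg.
exists U; apply: bopP => z; rewrite !bop_mulE SE bopZ UE.
by have [_ _ _ gZ] := scalar_functional bg.1; rewrite gZ gTx mulr1.
Qed.

(** For a rank one T with S T nonzero, the factorization S = S T U S passes through T. *)
Lemma order_minimal_rank_one S : order_minimal S -> at_most_rank_one S.
Proof.
move=> Smin; have [x Sx] := bop_neq0 Smin.1.
have x0 : x != 0 by apply: contraNneq Sx => ->; rewrite bop0.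
have [f bf fx] := hahn_banach x0; have [T TE] := rank_one_exists x bf.
have STx : (S * T) x = S x by rewrite bop_mulE TE fx scale1r.
have ST0 : S * T <> 0 by move=> e; move: Sx; rewrite -STx e eqxx.
have Tmin : left_minimal T.
  apply: rank_one_left_minimal; first by exists x, f.
  by move=> T0; apply: ST0; rewrite T0 mulr0.
have [U SE] := order_minimal_factor bop_semiprime Smin Tmin ST0.
exists (S x), (f \o (U * S)); split; first exact: bounded_functional_comp.
by move=> z; rewrite [in LHS]SE !bop_mulE TE bopZ.
Qed.

End BoundedOperatorAlgebra.

(** * Surjective linear maps preserving the minus order both ways *)

Section MinusOrderPreservers.
Variables (R : realType) (A : banachAlgType R[i]) (X : normedModType R[i]).
Variable Phi : {linear A -> bounded_op X}.
Hypothesis A_semiprime : semiprime A.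
Hypothesis A_enough : enough_minimal A.
Hypothesis Phi_surj : forall T, exists x, Phi x = T.
Hypothesis Phi_le : forall a b, minus_le a b <-> minus_le (Phi a) (Phi b).
Implicit Types (a b k u v : A) (x y z : X) (f g : X -> R[i]).

Lemma preserver_eq0 a : Phi a = 0 -> a = 0.
Proof.
by move=> a0; apply: minus_le0; apply/Phi_le; rewrite a0; exact: minus_0le.
Qed.

Lemma preserver_inj : injective Phi.
Proof.
move=> a b ab; apply/eqP; rewrite -subr_eq0; apply/eqP/preserver_eq0.
by rewrite linearB ab subrr.
Qed.

Lemma preserver_order_minimal a : order_minimal a <-> order_minimal (Phi a).
Proof.
have nz : a <> 0 <-> Phi a <> 0.
  split; first by move=> a0 /preserver_eq0.
  by move=> Pa0 a0; apply: Pa0; rewrite a0 linear0.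
split=> [[a0 amin]|[a0 amin]].
  split=> [|T]; first exact/nz.
  have [v <-] := Phi_surj T => /Phi_le/amin[]->; last by right.
  by left; rewrite linear0.
split=> [|v]; first exact/nz.
by move=> /Phi_le/amin[/preserver_eq0|/preserver_inj]; [left|right].
Qed.

(** The bridge is order-minimality, which Phi preserves and which amounts to left-minimality in A
    and to rank one in B(X). *)
Lemma preserver_rank_one u :
  u = 0 \/ left_minimal u <-> at_most_rank_one (Phi u).
Proof.
split=> [[->|umin]|].
- rewrite linear0; exists 0, (fun=> 0); split.
    split=> [c x y|]; first by rewrite mulr0 addr0.
    by exists 0 => x; rewrite normr0 mul0r.
  by move=> z; rewrite scale0r.
- by apply/order_minimal_rank_one/preserver_order_minimal/left_minimal_order.
- move=> Pu; have [->|u0] := pselect (u = 0); [by left|right].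
  apply: order_minimal_left => //; apply/preserver_order_minimal.
  apply: left_minimal_order; first exact: bop_semiprime.
  by apply: rank_one_left_minimal => // /preserver_eq0.
Qed.

Lemma minimal_or0_mull k u : left_minimal u ->
  k * u = 0 \/ left_minimal (k * u).
Proof.
move=> umin; have [|ku0] := pselect (k * u = 0); first by left.
by right; exact: left_minimal_mull.
Qed.

Lemma minimal_or0_mulr k u : left_minimal u ->
  u * k = 0 \/ left_minimal (u * k).
Proof.
move=> umin; have [|ku0] := pselect (u * k = 0); first by left.
by right; exact: left_minimal_mulr.
Qed.

(* Among rank one operators x (x) f, the spaces x (x) X^* and X (x) f are the
   maximal linear ones and two of them meet in at most a line.  Hence u A u, the
   intersection of u A and A u, is a line. *)
Lemma minimal_scalar u : left_minimal u ->
  forall k, exists c : R[i], u * k * u = c *: u.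
Proof.
move=> umin k; apply: contrapT => nc; set v := u * k * u in nc.
have /preserver_rank_one[x [f [bf uE]]] : u = 0 \/ left_minimal u by right.
have vmin : v = 0 \/ left_minimal v.
  by rewrite /v -mulrA; apply: minimal_or0_mulr.
have /preserver_rank_one[y [g [bg vE]]] := vmin.
have [f0 fD fB fZ] := scalar_functional bf.1.
have [g0 gD gB gZ] := scalar_functional bg.1.
have not_prop c : ~ forall z, g z *: y = (c * f z) *: x.
  move=> cfg; apply: nc; exists c; apply: preserver_inj.
  by apply: bopP => z; rewrite linearZZ bop_scaleE vE uE scalerA.
have neq0 : Phi u <> 0 by move=> /preserver_eq0; exact: umin.1.
have x0 : x != 0.
  apply: contra_notN neq0 => /eqP x0; apply: bopP => z.
  by rewrite uE x0 scaler0.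
have fn0 : exists z, f z != 0.
  have [z] := bop_neq0 neq0; rewrite uE scaler_eq0 negb_or => /andP[fz _].
  by exists z.
(* Such an r lies in A u or in u A; since v lies in both, r + v lies in the same one. *)
have adj r : r = 0 \/ left_minimal r -> r <> 0 ->
    u + r = 0 \/ left_minimal (u + r) -> at_most_rank_one (Phi r + Phi v).
  move=> [//|rmin] _ ur; rewrite -linearD; apply/preserver_rank_one.
  have [[h ->]|[h ->]] := left_minimal_add A_semiprime umin rmin ur.
    by rewrite /v -mulrDl; exact: minimal_or0_mull.
  by rewrite /v -mulrA -mulrDr; exact: minimal_or0_mulr.
have [p [h [bh uvE]]] : at_most_rank_one (Phi u + Phi v).
  rewrite -linearD; apply/preserver_rank_one.
  have -> : u + v = u * (1 + k * u) by rewrite mulrDr mulr1 mulrA.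
  exact: minimal_or0_mulr.
have fgh z : f z *: x + g z *: y = h z *: p.
  by rewrite -uvE bop_addE uE vE.
have [[c gE]|[c yE]] := rank_one_sum bf.1 bg.1 fgh x0 fn0.
- have cy_prop d : c *: y <> d *: x.
    move=> cyx; apply: (not_prop d) => z.
    by rewrite gE (mulrC c) -(scalerA (f z) c) cyx scalerA mulrC.
  (* Here v is (c y) (x) f with c y off the line of x. A [w] in the kernel of f gives f' independent
     of f, and r = x (x) f' contradicts [adj]. *)
  have [w w0 fw] : exists2 w, w != 0 & f w = 0.
    have [fx0|fx] := eqVneq (f x) 0; first by exists x.
    exists (c *: y - (f (c *: y) / f x) *: x); last first.
      by rewrite fB fZ fZ divfK// subrr.
    by apply/eqP => /eqP; rewrite subr_eq0 => /eqP; exact: cy_prop.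
  have [f' bf' f'w] := hahn_banach w0.
  have [Q QE] := rank_one_exists x bf'; have [r rQ] := Phi_surj Q.
  have rr1 : at_most_rank_one (Phi r) by rewrite rQ; exists x, f'.
  have r0 : r <> 0.
    move=> r0; move: x0; rewrite -[x]scale1r -f'w -QE -rQ r0 linear0.
    by rewrite eqxx.
  have ur : u + r = 0 \/ left_minimal (u + r).
    apply/preserver_rank_one; rewrite linearD rQ.
    exists x, (fun z => f z + f' z); split; first exact: bounded_functionalD.
    by move=> z; rewrite bop_addE uE QE scalerDl.
  have [p' [h' [bh' rvE]]] := adj r (proj2 (preserver_rank_one r) rr1) r0 ur.
  have f'fh z : f' z *: x + f z *: (c *: y) = h' z *: p'.
    by rewrite -rvE bop_addE rQ QE vE gE scalerA mulrC.
  have f'n0 : exists z, f' z != 0 by exists w; rewrite f'w oner_neq0.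
  have [[d fE]|[d cyE]] := rank_one_sum bf'.1 bf.1 f'fh x0 f'n0.
  + have d0 : d = 0 by have := fE w; rewrite fw f'w mulr1.
    by have [z] := fn0; rewrite fE d0 mul0r eqxx.
  + exact: cy_prop cyE.
- pose g' z := c * g z.
  have bg' : bounded_functional g' by exact: bounded_functionalZ.
  have g'_prop d : ~ forall z, g' z = d * f z.
    move=> g'E; apply: (not_prop d) => z.
    by rewrite yE scalerA mulrC -/(g' z) g'E.
  (* Dual case: x' off the line of x gives r = x' (x) f. Were X a line, all functionals would be
     multiples of f. *)
  have [x' x'x] : exists x', forall d, x' <> d *: x.
    apply: contrapT => /forallNP nx'.
    have Xx z : exists d, z = d *: x.
      by apply: contrapT => /forallNP zx; exact: (nx' z).
    have fx : f x != 0.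
      apply/eqP => fx; have [z] := fn0; have [d ->] := Xx z.
      by rewrite fZ fx mulr0 eqxx.
    apply: (g'_prop (g' x / f x)) => z; have [d ->] := Xx z.
    by rewrite fZ mulrCA divfK// /g' gZ mulrCA.
  have x'0 : x' != 0 by apply/eqP => x'0; apply: (x'x 0); rewrite scale0r.
  have [Q QE] := rank_one_exists x' bf; have [r rQ] := Phi_surj Q.
  have rr1 : at_most_rank_one (Phi r) by rewrite rQ; exists x', f.
  have r0 : r <> 0.
    move=> r0; have [z fz] := fn0; move: (QE z).
    rewrite -rQ r0 linear0 => /esym/eqP.
    by rewrite scaler_eq0 (negPf fz) (negPf x'0).
  have ur : u + r = 0 \/ left_minimal (u + r).
    apply/preserver_rank_one; rewrite linearD rQ.
    exists (x + x'), f; split=> // z.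
    by rewrite bop_addE uE QE scalerDr.
  have [p' [h' [bh' rvE]]] := adj r (proj2 (preserver_rank_one r) rr1) r0 ur.
  have fg'h z : f z *: x' + g' z *: x = h' z *: p'.
    by rewrite -rvE bop_addE rQ QE vE yE scalerA mulrC.
  have [[d g'E]|[d xE]] := rank_one_sum bf.1 bg'.1 fg'h x'0 fn0.
  + exact: g'_prop g'E.
  + apply: (x'x d^-1); rewrite xE scalerK//.
    by apply: contraNneq x0 => d0; rewrite xE d0 scale0r.
Qed.

Lemma scaled_minus_le a b u (c : R[i]) : b * a = 1 -> a * b = 1 ->
  u * b * u = c *: u -> c != 0 -> minus_le (c^-1 *: u) a.
Proof.
move=> ba ab ubu c0; apply: minus_le_of_inverse ba ab _.
by rewrite -!scalerAl -!scalerAr ubu scalerK.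
Qed.

(* If u b u = 0 and u r u = u, then s = u r a satisfies s <= a and s + u <= a,
   so that u is a difference of two elements below a. *)
Lemma preserver_factor a b u : b * a = 1 -> a * b = 1 -> left_minimal u ->
  (exists P, Phi u = P * Phi a) /\ (exists Q, Phi u = Phi a * Q).
Proof.
move=> ba ab umin; have [c ubu] := minimal_scalar umin b.
have [c0|c0] := eqVneq c 0; last first.
  have /Phi_le/minus_le_eq[p [q [pE qE _ _]]] := scaled_minus_le ba ab ubu c0.
  have uE : Phi u = c *: Phi (c^-1 *: u).
    by rewrite -linearZZ scalerA mulfV// scale1r.
  split; [exists (c *: p)|exists (c *: q)]; rewrite uE.
    by rewrite pE; apply: bopP => z.
  by rewrite qE; apply: bopP => z; rewrite bop_mulE !bop_scaleE bopZ.
have [r rE] := left_minimal_regular1 A_semiprime umin.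
rewrite c0 scale0r in ubu; pose s := u * r * a.
have sbs : s * b * s = s.
  by rewrite /s -(mulrA (u * r) a) ab mulr1 !mulrA rE.
have sbu : s * b * u = u by rewrite /s -(mulrA (u * r) a) ab mulr1 rE.
have ubs : u * b * s = 0 by rewrite /s !mulrA ubu !mul0r.
have subu : (s + u) * b * (s + u) = s + u.
  by rewrite !mulrDl !mulrDr sbs sbu ubs ubu addr0 addr0.
have /Phi_le/minus_le_eq[p [q [pE qE _ _]]] := minus_le_of_inverse ba ab sbs.
have /Phi_le/minus_le_eq[p' [q' [pE' qE' _ _]]] :=
  minus_le_of_inverse ba ab subu.
have uE : Phi u = Phi (s + u) - Phi s by rewrite -linearB addrC addKr.
split; [exists (p' - p)|exists (q' - q)]; rewrite uE.
  by rewrite pE pE' mulrBl.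
by rewrite qE qE' mulrBr.
Qed.

(** A rank one operator fixing x factors through Phi a on both sides, so x is in the range and,
    unless zero, not in the kernel. [S] is a bare function, not yet known to be bounded. *)
Lemma preserver_bijective a b : b * a = 1 -> a * b = 1 ->
  exists S : X -> X, (forall x, Phi a (S x) = x) /\ (forall x, S (Phi a x) = x).
Proof.
move=> ba ab; have fac x : x != 0 ->
    (exists y, Phi a y = x) /\ (Phi a x = 0 -> x = 0).
  move=> x0; have [f bf fx] := hahn_banach x0.
  have [U UE] := rank_one_exists x bf; have [u uU] := Phi_surj U.
  have Ux : Phi u x = x by rewrite uU UE fx scale1r.
  have u0 : u <> 0.
    by move=> u0; move: x0; rewrite -Ux u0 linear0 eqxx.
  have /preserver_rank_one[//|umin] : at_most_rank_one (Phi u).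
    by rewrite uU; exists x, f.
  have [[P PE] [Q QE]] := preserver_factor ba ab umin; split.
    by exists (Q x); rewrite -bop_mulE -QE.
  by move=> ax; rewrite -Ux PE bop_mulE ax bop0.
have /choice[S SE] : forall x, exists y, Phi a y = x.
  move=> x; have [->|/fac[]//] := eqVneq x 0; by exists 0; rewrite bop0.
exists S; split=> // x; apply/eqP; rewrite -subr_eq0; apply/eqP.
have [//|/fac[_]] := eqVneq (S (Phi a x) - x) 0; apply.
by rewrite bopB SE subrr.
Qed.

(** Both f (S x) and c are the scalars t of the overview. When m is nonzero, m^-1 Phi u lies below
    Phi a and pulling back gives c = m; when c is nonzero, c^-1 u lies below a and is pushed
    forward. *)
Lemma preserver_trace a b (S : X -> X) u x f (c : R[i]) :
  b * a = 1 -> a * b = 1 ->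
  (forall x, Phi a (S x) = x) -> (forall x, S (Phi a x) = x) ->
  left_minimal u -> bounded_functional f -> (forall z, Phi u z = f z *: x) ->
  u * b * u = c *: u -> f (S x) = c.
Proof.
move=> ba ab TS ST umin bf uE ubu; set m := f (S x).
have neq0 : Phi u <> 0 by move=> /preserver_eq0; exact: umin.1.
have [z0] := bop_neq0 neq0.
rewrite uE scaler_eq0 negb_or => /andP[fz0 x0].
have [f0 fD fB fZ] := scalar_functional bf.1.
have mc : m != 0 -> c = m.
  (* [P] and [Q] are bounded versions of Phi u S and S Phi u, which supply the idempotents. *)
  move=> m0; have [[P PE] [Q QE]] := preserver_factor ba ab umin.
  pose v := m^-1 *: u; pose p := m^-1 *: P; pose q := m^-1 *: Q.
  have vE z : Phi v z = (m^-1 * f z) *: x.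
    by rewrite linearZZ bop_scaleE uE scalerA.
  have pE z : p (Phi a z) = Phi v z.
    by rewrite linearZZ !bop_scaleE PE bop_mulE.
  have qE z : Phi a (q z) = Phi v z.
    by rewrite linearZZ !bop_scaleE bopZ QE bop_mulE.
  have px : p x = x by rewrite -[in LHS](TS x) pE vE mulVf// scale1r.
  have pv z : p (Phi v z) = Phi v z by rewrite vE bopZ px.
  have pvE : Phi v = p * Phi a by apply: bopP => z; rewrite bop_mulE pE.
  have qvE : Phi v = Phi a * q by apply: bopP => z; rewrite bop_mulE qE.
  have vv : minus_le (Phi v) (Phi a).
    exists p, q; split.
    - split; apply: bopP => z; rewrite bop_mulE.
        by rewrite -[z]TS pE pv.
      by rewrite -[LHS]ST -[RHS]ST !qE -pE qE pv.
    - apply/seteqP; split=> W; rewrite /ann_l /= => W0; last first.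
        by rewrite pvE mulrA W0 mul0r.
      by apply: bopP => z; rewrite -[z]TS bop_mulE pE -bop_mulE W0.
    - apply/seteqP; split=> W; rewrite /ann_r /= => W0; last first.
        by rewrite qvE -mulrA W0 mulr0.
      have S0 : S 0 = 0 by rewrite -{1}(bop0 (Phi a)) ST.
      apply: bopP => z; rewrite bop_mulE -[LHS]ST qE -bop_mulE W0.
      exact: S0.
    - by rewrite -pvE; apply: bopP => z; rewrite bop_mulE pv.
    - rewrite -qvE; apply: bopP => z.
      by rewrite bop_mulE -[LHS]pE qE pv.
  have vbv := minus_le_inverse ab (proj2 (Phi_le v a) vv).
  have /eqP : (m^-1 * m^-1 * c) *: u = m^-1 *: u.
    by rewrite -[RHS]vbv /v -!scalerAl -!scalerAr ubu !scalerA.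
  rewrite -subr_eq0 -scalerBl scaler_eq0 => /orP[|/eqP u0]; last first.
    by case: umin.1.
  rewrite subr_eq0 => /eqP mE.
  apply: (mulfI (mulf_neq0 (invr_neq0 m0) (invr_neq0 m0))).
  by rewrite mE -mulrA mulVf// mulr1.
have [c0|c0] := eqVneq c 0.
  apply/eqP/negPn/negP; rewrite c0 => m0; move: (m0).
  by rewrite -(mc m0) c0 eqxx.
have /Phi_le/minus_le_eq[p [q [pE _ pv _]]] := scaled_minus_le ba ab ubu c0.
set v := c^-1 *: u in pE pv.
have vE z : Phi v z = (c^-1 * f z) *: x.
  by rewrite linearZZ bop_scaleE uE scalerA.
(* This puts x in the range of Phi v, which [p] fixes; hence Phi v (S x) = p x = x. *)
pose z1 := (c / f z0) *: z0.
have vz1 : Phi v z1 = x by rewrite vE fZ divfK// mulVf// scale1r.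
have : Phi v (S x) = x.
  by rewrite pE bop_mulE TS -[in LHS]vz1 -bop_mulE pv.
rewrite vE -/m -[in RHS](scale1r x) => /eqP; rewrite -subr_eq0 -scalerBl.
rewrite scaler_eq0 (negPf x0) orbF subr_eq0 => /eqP cm.
by apply: (mulfI (invr_neq0 c0)); rewrite cm mulVf.
Qed.

(* a^-1 + (1 - a)^-1 = (a (1 - a))^-1, and inverses correspond through the
   traces of the minimal elements. *)
Lemma preserver_square_invertible a b b' (C : X -> X) :
  b * a = 1 -> a * b = 1 -> b' * (1 - a) = 1 -> (1 - a) * b' = 1 ->
  (forall x, Phi 1 (C x) = x) -> (forall x, C (Phi 1 x) = x) ->
  forall w, Phi (a * a) w = Phi a (C (Phi a w)).
Proof.
move=> ba ab b'a' a'b' cC Cc w; pose a' := 1 - a.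
have aa' : a * a' = a' * a by rewrite /a' mulrBl mulrBr mulr1 mul1r.
have bb' : b + b' = b * b'.
  have -> : b + b' = b * (a' + a) * b'.
    by rewrite mulrDr mulrDl ba mul1r -mulrA a'b' mulr1.
  by rewrite subrK mulr1.
have inv1 : (b + b') * (a * a') = 1.
  by rewrite bb' aa' mulrA -(mulrA b) b'a' mulr1.
have inv2 : a * a' * (b + b') = 1.
  by rewrite bb' aa' mulrA -(mulrA a') ab mulr1.
have [S1 [TS1 ST1]] := preserver_bijective ba ab.
have [S2 [TS2 ST2]] := preserver_bijective b'a' a'b'.
have [S3 [TS3 ST3]] := preserver_bijective inv1 inv2.
have S0 d (S : X -> X) : (forall x, S (Phi d x) = x) -> S 0 = 0.
  by move=> SK; rewrite -{1}(bop0 (Phi d)) SK.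
have SD x : S3 x = S1 x + S2 x.
  (* For nonzero x, each functional f gives a rank one element whose traces are additive in the
     inverse, and functionals separate points. *)
  have [->|x0] := eqVneq x 0.
    by rewrite (S0 _ _ ST1) (S0 _ _ ST2) (S0 _ _ ST3) addr0.
  apply/eqP; rewrite -subr_eq0; apply/eqP/functional_separates => f bf.
  have [f0 fD fB fZ] := scalar_functional bf.1.
  have [U UE] := rank_one_exists x bf; have [u uU] := Phi_surj U.
  have uE z : Phi u z = f z *: x by rewrite uU UE.
  have /preserver_rank_one[u0|umin] : at_most_rank_one (Phi u).
    by exists x, f.
    have := uE (S3 x - (S1 x + S2 x)); rewrite u0 linear0 => /esym/eqP.
    by rewrite scaler_eq0 (negPf x0) orbF => /eqP.
  have [c1 c1E] := minimal_scalar umin b.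
  have [c2 c2E] := minimal_scalar umin b'.
  have c3E : u * (b + b') * u = (c1 + c2) *: u.
    by rewrite mulrDr mulrDl c1E c2E scalerDl.
  rewrite fB fD (preserver_trace ba ab TS1 ST1 umin bf uE c1E).
  rewrite (preserver_trace b'a' a'b' TS2 ST2 umin bf uE c2E).
  by rewrite (preserver_trace inv1 inv2 TS3 ST3 umin bf uE c3E) subrr.
have a'E z : Phi a' z = Phi 1 z - Phi a z by rewrite linearB.
have S2E y : S2 (Phi a y) = S2 (Phi 1 y) - y.
  rewrite -[RHS]ST2; congr S2; rewrite bopB TS2.
  by rewrite [Phi (1 - a) y]a'E opprB addrC subrK.
have CE : C (Phi a' w) = w - C (Phi a w).
  by rewrite -[RHS]Cc bopB cC -a'E.
(* [S3] maps the left side to w: its [S1] part is C (Phi a' w), and its [S2] part is w - C (Phi a'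
   w). *)
have : Phi a (C (Phi a' w)) = Phi (a * a') w.
  rewrite -[LHS]TS3; congr (Phi _ _).
  by rewrite SD ST1 S2E cC addrC subrK ST2.
rewrite CE bopB mulrBr mulr1 linearB bop_addE => /addrI /oppr_inj.
by move=> ->.
Qed.

(** For large t, both e = a - t and 1 - e = - (a - (t + 1)) are invertible. Expanding the identity
    for [e] adds the same terms in t to both sides. *)
Lemma preserver_square a (C : X -> X) :
  (forall x, Phi 1 (C x) = x) -> (forall x, C (Phi 1 x) = x) ->
  forall w, Phi (a * a) w = Phi a (C (Phi a w)).
Proof.
move=> cC Cc w; have [M M0 MP] := shift_invertible a.
pose t := M + 1; pose e := a - t%:A.
have t0 : 0 < t by rewrite ltr_wpDl.
have [|b [ba ab]] := MP t _ (lt0r_neq0 t0).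
  by rewrite gtr0_norm// lerDl.
have t1 : 0 < t + 1 by rewrite ltr_wpDl// ltW.
have [|b' [b'a a'b']] := MP (t + 1) _ (lt0r_neq0 t1).
  by rewrite gtr0_norm// /t -addrA lerDl addr_ge0.
have a'E : 1 - e = - (a - (t + 1)%:A).
  by rewrite /e (scalerDl 1 t 1) scale1r !opprB addrA (addrC 1).
have := @preserver_square_invertible e b (- b') C ba ab _ _ cC Cc w.
rewrite a'E mulrNN mulNr mulrN opprK => /(_ b'a a'b').
have eE z : Phi e z = Phi a z - t *: Phi 1 z.
  by rewrite linearB linearZZ bop_subE.
have CE : C (Phi e w) = C (Phi a w) - t *: w.
  by rewrite -[RHS]Cc bopB cC bopZ -eE.
rewrite CE eE !bopB !bopZ cC.
have -> : e * e = a * a - t *: a - t *: e.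
  by rewrite {2}/e mulrBr mulr_algr {1}/e mulrBl mulr_algl.
rewrite !(linearB Phi) !(linearZZ Phi) !bop_subE !bop_scaleE eE.
by move=> /addIr /addIr.
Qed.

End MinusOrderPreservers.

(** * Assembly of both implications *)

Lemma bop_double (R : realType) (X : normedModType R[i]) (S : bounded_op X) :
  S + S = 0 -> S = 0.
Proof.
move=> SS; apply: bopP => z; have : (2 : R[i]) *: S z = 0.
  by rewrite scaler_nat mulr2n -bop_addE SS.
by move=> /eqP; rewrite scaler_eq0 pnatr_eq0 => /eqP.
Qed.

Theorem theorem3p4 (R : realType) (A : banachAlgType R[i])
    (X : completeNormedModType R[i])
    (hss : semisimple A) (hsoc : essential_ideal (socle A))
    (Phi : {linear A -> bounded_op X})
    (hsurj : forall T : bounded_op X, exists x : A, Phi x = T) :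
  (forall a b : A, minus_le a b <-> minus_le (Phi a) (Phi b))
  <->
  (exists (c : bounded_op X) (Psi : A -> bounded_op X),
     [/\ invertible c,
         algebra_isomorphism Psi \/ algebra_antiisomorphism Psi
       & forall x : A, Phi x = c * Psi x]).
Proof.
split=> [Phi_le|[c [Psi [[d [cd dc]] Psi_hom PhiE]]] a b]; last first.
  have PhiE' x : Psi x = d * Phi x by rewrite PhiE mulrA dc mul1r.
  have PsiP : minus_le a b <-> minus_le (Psi a) (Psi b).
    case: Psi_hom => [[lPsi [g PsiK gK] _ PsiM]|[lPsi [g PsiK gK] _ PsiM]].
      have Psi0 : Psi 0 = 0.
        by have := lPsi (-1) 0 0; rewrite scaler0 addr0 scaleN1r addNr.
      have g0 : g 0 = 0 by rewrite -Psi0 PsiK.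
      have gM : {morph g : x y / x * y}.
        by move=> x y; rewrite -{1}[x]gK -{1}[y]gK -PsiM PsiK.
      split; first exact: minus_le_iso.
      by move=> /(minus_le_iso gK PsiK g0 gM); rewrite !PsiK.
    have Psi0 : Psi 0 = 0.
      by have := lPsi (-1) 0 0; rewrite scaler0 addr0 scaleN1r addNr.
    have g0 : g 0 = 0 by rewrite -Psi0 PsiK.
    have gM x y : g (x * y) = g y * g x.
      by rewrite -{1}[x]gK -{1}[y]gK -PsiM PsiK.
    split; first exact: minus_le_antiiso.
    by move=> /(minus_le_antiiso gK PsiK g0 gM); rewrite !PsiK.
  rewrite PsiP; split=> [/(minus_leMl dc cd)|/(minus_leMl cd dc)].
    by rewrite -!PhiE.
  by rewrite -!PhiE'.
have A_sp := semisimple_semiprime hss.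
have A_en := essential_socle_enough_minimal A_sp hsoc.
have [C [cC Cc]] :=
  preserver_bijective A_sp A_en hsurj Phi_le (mulr1 1) (mulr1 1).
have sq := preserver_square A_sp A_en hsurj Phi_le _ cC Cc.
(* With Phi v = 1 the square identity reads d z = C z, so the bare inverse C of Phi 1 is a bounded
   operator. *)
have [v vE] := hsurj 1; pose d := Phi (v * v).
have dE z : d z = C z by rewrite /d sq vE.
have cd : Phi 1 * d = 1 by apply: bopP => z; rewrite bop_mulE dE cC.
have dc : d * Phi 1 = 1 by apply: bopP => z; rewrite bop_mulE dE Cc.
pose Psi x := d * Phi x.
have PsiB : zmod_morphism Psi by move=> x y; rewrite /Psi linearB mulrBr.
pose f : {additive A -> bounded_op X} :=
  HB.pack Psi (GRing.isZmodMorphism.Build _ _ Psi PsiB).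
have PhiE x : Phi x = Phi 1 * Psi x by rewrite /Psi mulrA cd mul1r.
have f_surj T : exists x, f x = T.
  have [x xE] := hsurj (Phi 1 * T); exists x.
  by rewrite /f /= /Psi xE mulrA dc mul1r.
have PsiJ x : Psi (x * x) = Psi x * Psi x.
  by apply: bopP => z; rewrite /Psi !bop_mulE (sq x) -dE.
have Psi_lin : linear Psi.
  move=> k x y; rewrite /Psi linearP mulrDr; congr (_ + _).
  by apply: bopP => z; rewrite bop_mulE !bop_scaleE bopZ.
have Psi_bij : bijective Psi.
  have [g gE] := choice f_surj; exists g => // x.
  apply: (preserver_inj Phi_le); rewrite [LHS]PhiE [RHS]PhiE.
  by congr (_ * _); exact: gE.
exists (Phi 1), Psi; split=> //; first by exists d.
have [fM|fM] :=
    jordan_hom_or_antihom f_surj PsiJ (@bop_double R X) (@bop_prime R X).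
  by left; split.
by right; split.
Qed.
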